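(* Let $\mathsf{M}\in\mathbb{C}^{D\times D}$ be an invertible matrix and let $\{\mathsf{M}_{\mu\nu}\}_{1\le\mu,\nu\le n}$ be an arbitrary partition of $\mathsf{M}$. Let $\mathcal{G}$ be the graph of the partition $\{(\mathsf{M}-\mathsf{I})_{\mu\nu}\}$ of $\mathsf{M}-\mathsf{I}$ (same projectors), and let $\mathcal{G}_0$ be $\mathcal{G}$ with all self-loops deleted. Then, as long as all of the required inverses (those in the definition of the quantities $\mathsf{F}$ below) exist, for all $\alpha,\omega$ the partition of $\mathsf{M}^{-1}$ is given by $$(\mathsf{M}^{-1})_{\omega\alpha}=\sum_{P_{\mathcal{G}_0;\alpha\omega}} (-1)^\ell\, \mathsf{F}_{\mathcal{G}\backslash\{\alpha,\nu_2,\ldots,\nu_\ell\}}[\omega]\,\mathsf{M}_{\omega\nu_\ell}\cdots \mathsf{F}_{\mathcal{G}\backslash\{\alpha\}}[\nu_2]\,\mathsf{M}_{\nu_2\alpha}\,\mathsf{F}_{\mathcal{G}}[\alpha],$$ where the sum runs over all paths $(\alpha,\nu_2,\ldots,\nu_\ell,\omega)$ from $\alpha$ to $\omega$ on $\mathcal{G}_0$, $\ell$ is the length of the path, and $\mathsf{F}$ is defined recursively (for $\mathcal{G}$ and, in the same way, for each graph obtained from it by deleting vertices) by $$\mathsf{F}_{\mathcal{G}}[\alpha] = \left[\mathsf{M}_{\alpha} - \sum_{C_{\mathcal{G}_0;\alpha}}(-1)^m\,\mathsf{M}_{\alpha\mu_m}\, \mathsf{F}_{\mathcal{G}\backslash\{\alpha,\mu_2,\ldots,\mu_{m-1}\}}[\mu_m]\cdots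 \mathsf{F}_{\mathcal{G}\backslash\{\alpha\}}[\mu_2]\,\mathsf{M}_{\mu_2\alpha}\right]^{-1},$$ where the sum runs over all bare cycles $(\alpha,\mu_2,\ldots,\mu_m,\alpha)$ off $\alpha$ on $\mathcal{G}_0$ and $m$ is the length of the bare cycle.
   Context: Partition of a matrix: let $V=V_1\oplus\cdots\oplus V_n=\mathbb{C}^D$, where each $V_\mu$ (of dimension $d_\mu\geq 1$) is spanned by a subset of the standard orthonormal basis vectors, these subsets being disjoint. Let $\mathsf{R}_\mu\in\mathbb{C}^{d_\mu\times D}$ be the restriction to these coordinates, so $\mathsf{R}_\mu^{\mathrm T}\mathsf{R}_\mu=\varepsilon_\mu$ is the orthogonal projector onto $V_\mu$. The corresponding partition of a $D\times D$ matrix $\mathsf{A}$ is the family $\mathsf{A}_{\mu\nu}=\mathsf{R}_\mu\mathsf{A}\mathsf{R}_\nu^{\mathrm T}$ (of size $d_\mu\times d_\nu$), $1\le\mu,\nu\le n$; equivalently, up to a permutation of the coordinates, a block decomposition of $\mathsf{A}$. One writes $\mathsf{A}_\mu=\mathsf{A}_{\mu\mu}$. The partition of a matrix function $f(\mathsf{M})$ is taken with the same projectors. $\mathsf{I}$ is the identity matrix of the appropriate size. Graph of a partition $\{\mathsf{A}_{\mu\nu}\}$: the directed graph with vertices labelled $1,\ldots,n$ and with a directed edge from $\nu$ to $\mu$, written $(\nu\mu)$, whenever $\mathsf{A}_{\mu\nu}\neq 0$ (self-loops included). $\mathcal{G}\backslash\{\alpha,\beta,\ldots\}$ is $\mathcal{G}$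 with the vertices $\alpha,\beta,\ldots$ deleted; a subscript $0$ means that all self-loops are deleted. Path: a walk whose vertices are all distinct; its length is its number of edges. $P_{\mathcal{G};\alpha\omega}$ is the set of paths from $\alpha$ to $\omega$; if $\omega=\alpha$ it consists only of the length-zero path, which contributes $\mathsf{F}_{\mathcal{G}}[\alpha]$. Bare cycle off $\alpha$: a closed walk of positive length from $\alpha$ to $\alpha$ that does not revisit any internal vertex and visits $\alpha$ only at its ends; $C_{\mathcal{G};\alpha}$ is the set of these. An empty sum is zero, so if $\alpha$ has no neighbours in the graph, $\mathsf{F}[\alpha]=\mathsf{M}_\alpha^{-1}$. *)

(* Defs.v *)
From mathcomp Require Import all_boot all_order all_algebra.
From mathcomp Require Export complex reals.

Set Implicit Arguments.
Unset Strict Implicit.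
Unset Printing Implicit Defensive.

Import GRing.Theory.
Local Open Scope ring_scope.

(** * Partitions of a matrix *)

(* [S mu] is the set of the standard basis vectors that span V_mu. *)
Definition coord_partition (D n : nat) (S : 'I_n -> {set 'I_D}) : Prop :=
  [/\ forall mu, S mu != set0,
      forall mu nu, mu != nu -> [disjoint S mu & S nu]
    & \bigcup_mu S mu = [set: 'I_D]].

(* R_mu; the coordinates in [S mu] are listed in increasing order. *)
Definition restr (K : fieldType) (D n : nat) (S : 'I_n -> {set 'I_D})
    (mu : 'I_n) : 'M[K]_(#|S mu|, D) :=
  \matrix_(i, j) (enum_val i == j)%:R.

Definition block (K : fieldType) (D n : nat) (S : 'I_n -> {set 'I_D})
    (A : 'M[K]_D) (mu nu : 'I_n) : 'M[K]_(#|S mu|, #|S nu|) :=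
  restr K S mu *m A *m (restr K S nu)^T.

(** * Directed graphs *)

Record digraph (n : nat) : Type := Digraph {
  vertices : {set 'I_n};
  edges : {set 'I_n * 'I_n}   (* (x, y) is the edge from x to y *)
}.

Definition adj (n : nat) (G : digraph n) : rel 'I_n :=
  fun x y => [&& x \in vertices G, y \in vertices G & (x, y) \in edges G].

Definition del_vertex (n : nat) (G : digraph n) (a : 'I_n) : digraph n :=
  Digraph (vertices G :\ a)
          [set e in edges G | (e.1 != a) && (e.2 != a)].

Definition del_vertices (n : nat) (G : digraph n) (s : seq 'I_n) : digraph n :=
  foldl (@del_vertex n) G s.

Definition del_loops (n : nat) (G : digraph n) : digraph n :=
  Digraph (vertices G) [set e in edges G | e.1 != e.2].

(* The edge from nu to mu is governed by the block A_(mu nu). *)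
Definition partition_graph (K : fieldType) (D n : nat)
    (S : 'I_n -> {set 'I_D}) (A : 'M[K]_D) : digraph n :=
  Digraph [set: 'I_n] [set e | block S A e.2 e.1 != 0].

(* The path is a :: p, so that its length is [size p]. *)
Definition is_path (n : nat) (G : digraph n) (a w : 'I_n) (p : seq 'I_n)
    : bool :=
  [&& a \in vertices G, path (adj G) a p, uniq (a :: p) & last a p == w].

(* The bare cycle is a :: rcons c a; its length is [(size c).+1]. *)
Definition is_bare_cycle (n : nat) (G : digraph n) (a : 'I_n) (c : seq 'I_n)
    : bool :=
  path (adj G) a (rcons c a) && uniq (a :: c).

(** * The quantities F *)

(* For p = [:: nu_2; ...; nu_l; w], with [last a p] = w:
   F_(G\{a, nu_2, ..., nu_l})[w] M_(w nu_l) ...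
     F_(G\{a})[nu_2] M_(nu_2 a) F_G[a]. *)
Fixpoint path_prod (K : fieldType) (D n : nat) (S : 'I_n -> {set 'I_D})
    (M : 'M[K]_D) (F : digraph n -> forall a : 'I_n, 'M[K]_(#|S a|))
    (G : digraph n) (a : 'I_n) (p : seq 'I_n)
    : 'M[K]_(#|S (last a p)|, #|S a|) :=
  match p return 'M[K]_(#|S (last a p)|, #|S a|) with
  | [::] => F G a
  | nu :: q => path_prod M F (del_vertex G a) nu q *m block S M nu a *m F G a
  end.

(* For c = [:: mu_2; ...; mu_m]:
   M_(a mu_m) F_(G\{a, mu_2, ..., mu_(m-1)})[mu_m] ...
     F_(G\{a})[mu_2] M_(mu_2 a).
   The empty c is a self-loop, which does not occur on loopless graphs. *)
Definition cycle_prod (K : fieldType) (D n : nat) (S : 'I_n -> {set 'I_D})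
    (M : 'M[K]_D) (F : digraph n -> forall a : 'I_n, 'M[K]_(#|S a|))
    (G : digraph n) (a : 'I_n) (c : seq 'I_n) : 'M[K]_(#|S a|) :=
  match c with
  | [::] => block S M a a
  | mu :: q =>
      block S M a (last mu q) *m path_prod M F (del_vertex G a) mu q
        *m block S M mu a
  end.

(* The matrix to be inverted in the definition of F_G[a]. The vertices in
   a :: c are distinct, so [size c < n] holds for every bare cycle. *)
Definition F_arg (K : fieldType) (D n : nat) (S : 'I_n -> {set 'I_D})
    (M : 'M[K]_D) (F : digraph n -> forall a : 'I_n, 'M[K]_(#|S a|))
    (G : digraph n) (a : 'I_n) : 'M[K]_(#|S a|) :=
  block S M a a
    - \sum_(j < n) \sum_(c : j.-tuple 'I_n | is_bare_cycle (del_loops G) a c)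
        (-1) ^+ j.+1 *: cycle_prod M F G a c.

Fixpoint F_rec (K : fieldType) (D n : nat) (S : 'I_n -> {set 'I_D})
    (M : 'M[K]_D) (k : nat) (G : digraph n) (a : 'I_n) : 'M[K]_(#|S a|) :=
  if k is k'.+1 then invmx (F_arg M (F_rec S M k') G a) else 0.

(* Each recursive call is on a graph with fewer vertices, so this fuel is
   enough: see [F_mxE]. *)
Definition F_mx (K : fieldType) (D n : nat) (S : 'I_n -> {set 'I_D})
    (M : 'M[K]_D) (G : digraph n) (a : 'I_n) : 'M[K]_(#|S a|) :=
  F_rec S M #|vertices G|.+1 G a.

Lemma leq_del_vertex (n : nat) (G : digraph n) (a : 'I_n) :
  (#|vertices (del_vertex G a)| <= #|vertices G|)%N.
Proof. by apply/subset_leq_card/subsetDl. Qed.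

Lemma eq_path_prod (K : fieldType) (D n : nat) (S : 'I_n -> {set 'I_D})
    (M : 'M[K]_D) (F F' : digraph n -> forall a : 'I_n, 'M[K]_(#|S a|))
    (G : digraph n) (a : 'I_n) (p : seq 'I_n) :
  (forall H b, (#|vertices H| <= #|vertices G|)%N -> F H b = F' H b) ->
  path_prod M F G a p = path_prod M F' G a p.
Proof.
elim: p G a => [|nu q IHq] G a eqF /=; first exact: eqF.
rewrite IHq ?eqF // => H b leH; apply: eqF.
exact: leq_trans leH (leq_del_vertex G a).
Qed.

Lemma eq_F_arg (K : fieldType) (D n : nat) (S : 'I_n -> {set 'I_D})
    (M : 'M[K]_D) (F F' : digraph n -> forall a : 'I_n, 'M[K]_(#|S a|))
    (G : digraph n) (a : 'I_n) :
  (forall H b, (#|vertices H| < #|vertices G|)%N -> F H b = F' H b) ->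
  F_arg M F G a = F_arg M F' G a.
Proof.
move=> eqF; congr (_ - _); apply: eq_bigr => j _; apply: eq_bigr => c.
case: (tval c) => [|mu q] //= /andP[/= /andP[/and3P[aG _ _] _] _].
congr (_ *: (_ *m _ *m _)); apply: eq_path_prod => H b leH; apply: eqF.
by apply: leq_ltn_trans leH _; rewrite [ltnRHS](cardsD1 a) aG.
Qed.

Lemma F_rec_stable (K : fieldType) (D n : nat) (S : 'I_n -> {set 'I_D})
    (M : 'M[K]_D) (k k' : nat) (G : digraph n) (a : 'I_n) :
  (#|vertices G| < k)%N -> (#|vertices G| < k')%N ->
  F_rec S M k G a = F_rec S M k' G a.
Proof.
elim: k k' G a => [|k IHk] [|k'] G a //= ltGk ltGk'.
by congr invmx; apply: eq_F_arg => H b ltHG; apply: IHk;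
  apply: leq_trans ltHG _.
Qed.

Lemma F_mxE (K : fieldType) (D n : nat) (S : 'I_n -> {set 'I_D})
    (M : 'M[K]_D) (G : digraph n) (a : 'I_n) :
  F_mx S M G a = invmx (F_arg M (F_mx S M) G a).
Proof.
congr invmx; apply: eq_F_arg => H b ltHG.
exact: F_rec_stable.
Qed.

(* All the inverses that F_G[a] involves, recursively, exist. The second
   hypothesis ranges over the factors F_(G\{a, mu_2, ..., mu_(i-1)})[mu_i]
   of the terms of the sum that defines F_G[a]. *)
Inductive F_exists (K : fieldType) (D n : nat) (S : 'I_n -> {set 'I_D})
    (M : 'M[K]_D) (G : digraph n) (a : 'I_n) : Prop :=
  F_exists_intro of
    F_arg M (F_mx S M) G a \in unitmx &
    (forall c1 mu c2, is_bare_cycle (del_loops G) a (c1 ++ mu :: c2) ->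
       F_exists S M (del_vertices G (a :: c1)) mu).

(* All the inverses in the sum over the paths from a to w exist. *)
Definition path_sum_exists (K : fieldType) (D n : nat)
    (S : 'I_n -> {set 'I_D}) (M : 'M[K]_D) (G : digraph n) (a w : 'I_n)
    : Prop :=
  forall p, is_path (del_loops G) a w p ->
  forall s1 nu s2, a :: p = s1 ++ nu :: s2 ->
    F_exists S M (del_vertices G s1) nu.

(* [path_prod] has [#|S (last a p)|] rows and [is_path] gives
   [last a p = w], so [conform_mx] is a mere cast here: its default
   value 0 is never used. As for cycles, [size p < n] for every path. *)
Definition path_sum (K : fieldType) (D n : nat)
    (S : 'I_n -> {set 'I_D}) (M : 'M[K]_D) (G : digraph n) (a w : 'I_n)
    : 'M[K]_(#|S w|, #|S a|) :=
  \sum_(l < n) \sum_(p : l.-tuple 'I_n | is_path (del_loops G) a w p)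
    (-1) ^+ l *: conform_mx 0 (path_prod M (F_mx S M) G a p).

(* Main.v *)
Require Import Defs.
From mathcomp Require Import all_boot all_order all_algebra.

(** If all the inverses exist, the formula is iterated elimination: in a graph
    H, let Y_w be the path sum from a to w. Splitting off the first step of
    each path gives Y = (e_a - sum_nu Y^(H\a, nu) M_(nu a)) F_H[a]; by induction
    M Y^(H\a, nu) = e_nu on H\a, hence M Y = e_a on H, the row of a being the
    definition of F_H[a].

    The hypotheses only give the inverses that the formula mentions, and the
    induction needs more. So replace M by N = (1 - t) M + t I over K(t), which
    has the same zero blocks off the diagonal. At t = 1 all the matrices to be
    inverted are I, so they are invertible over K(t) and the formula holds
    there. At t = 0, precisely the hypotheses ensure that every factor of the
    formula is regular, with the corresponding factor for M as its value. *)

Set Implicit Arguments.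
Unset Strict Implicit.
Unset Printing Implicit Defensive.

Import GRing.Theory.
Local Open Scope ring_scope.

(** * Places between fields, extended entrywise to matrices *)

Section Place.

Variables (L K : fieldType) (r : L -> K -> Prop).

(* [r x y] reads: x is regular at the place, with residue y. *)
Record place : Prop := Place {
  place0 : r 0 0;
  place1 : r 1 1;
  placeD : forall x x' y y', r x y -> r x' y' -> r (x + x') (y + y');
  placeN : forall x y, r x y -> r (- x) (- y);
  placeM : forall x x' y y', r x y -> r x' y' -> r (x * x') (y * y');
  placeV : forall x y, r x y -> y != 0 -> x != 0 /\ r x^-1 y^-1;
  place_fun : forall x y y', r x y -> r x y' -> y = y'
}.

Definition mplace m n (A : 'M[L]_(m, n)) (B : 'M[K]_(m, n)) : Prop :=
  forall i j, r (A i j) (B i j).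

Hypothesis rP : place.

Lemma place_sign k : r ((-1) ^+ k) ((-1) ^+ k).
Proof.
elim: k => [|k IHk]; first exact: (place1 rP).
by rewrite !exprS; apply: (placeM rP) => //; apply/placeN/place1.
Qed.

Lemma place_nat k : r k%:R k%:R.
Proof.
elim: k => [|k IHk]; first exact: (place0 rP).
by rewrite -addn1 !natrD; apply: (placeD rP) => //; apply: place1.
Qed.

Lemma place_sum I (s : seq I) (P : pred I) (F : I -> L) (F' : I -> K) :
  (forall i, P i -> r (F i) (F' i)) ->
  r (\sum_(i <- s | P i) F i) (\sum_(i <- s | P i) F' i).
Proof.
by move=> rF; apply: big_ind2 => //;
  [apply: (place0 rP) | move=> *; apply: placeD].
Qed.

Lemma place_prod I (s : seq I) (P : pred I) (F : I -> L) (F' : I -> K) :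
  (forall i, P i -> r (F i) (F' i)) ->
  r (\prod_(i <- s | P i) F i) (\prod_(i <- s | P i) F' i).
Proof.
by move=> rF; apply: big_ind2 => //;
  [apply: (place1 rP) | move=> *; apply: placeM].
Qed.

Lemma mplace0 m n : mplace (0 : 'M_(m, n)) 0.
Proof. by move=> i j; rewrite !mxE; apply: (place0 rP). Qed.

Lemma mplaceD m n (A A' : 'M_(m, n)) B B' :
  mplace A B -> mplace A' B' -> mplace (A + A') (B + B').
Proof. by move=> rA rA' i j; rewrite !mxE; apply: (placeD rP). Qed.

Lemma mplaceB m n (A A' : 'M_(m, n)) B B' :
  mplace A B -> mplace A' B' -> mplace (A - A') (B - B').
Proof.
by move=> rA rA' i j; rewrite !mxE; apply: (placeD rP) => //; apply: placeN.
Qed.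

Lemma mplaceZ m n x y (A : 'M_(m, n)) B :
  r x y -> mplace A B -> mplace (x *: A) (y *: B).
Proof. by move=> rx rA i j; rewrite !mxE; apply: (placeM rP). Qed.

Lemma mplaceM m n p (A : 'M_(m, n)) (A' : 'M_(n, p)) B B' :
  mplace A B -> mplace A' B' -> mplace (A *m A') (B *m B').
Proof.
by move=> rA rA' i j; rewrite !mxE; apply: place_sum => k _; apply: (placeM rP).
Qed.

Lemma mplace_sum m n I (s : seq I) (P : pred I)
    (F : I -> 'M_(m, n)) (F' : I -> 'M_(m, n)) :
  (forall i, P i -> mplace (F i) (F' i)) ->
  mplace (\sum_(i <- s | P i) F i) (\sum_(i <- s | P i) F' i).
Proof.
move=> rF; apply: big_ind2 => //; first exact: mplace0.
by move=> *; apply: mplaceD.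
Qed.

Lemma place_det n (A : 'M_n) B : mplace A B -> r (\det A) (\det B).
Proof.
move=> rA; apply: place_sum => s _; apply: (placeM rP); first exact: place_sign.
by apply: place_prod => i _.
Qed.

(** The determinant of [A] has a nonzero residue, so it is invertible with regular inverse; the
    entries of the adjugate are signed minors, hence regular too. *)
Lemma mplace_inv n (A : 'M_n) B :
  mplace A B -> B \in unitmx -> A \in unitmx /\ mplace (invmx A) (invmx B).
Proof.
move=> rA uB; have := uB; rewrite unitmxE unitfE => detB.
have [detA rV] := placeV rP (place_det rA) detB.
have uA : A \in unitmx by rewrite unitmxE unitfE.
split=> //; rewrite /invmx uA uB; apply: mplaceZ => // i j.
rewrite !mxE; apply: (placeM rP); first exact: place_sign.
by apply: place_det => k l; rewrite !mxE.
Qed.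

Lemma mplace_fun m n (A : 'M_(m, n)) B B' :
  mplace A B -> mplace A B' -> B = B'.
Proof. by move=> rB rB'; apply/matrixP => i j; apply: place_fun (rB i j) _. Qed.

Section Blocks.

Variables (D n : nat) (S : 'I_n -> {set 'I_D}).
Variables (N : 'M[L]_D) (M : 'M[K]_D) (rNM : mplace N M).

Lemma mplace_block mu nu : mplace (block S N mu nu) (block S M mu nu).
Proof.
by apply: mplaceM; first apply: mplaceM => //; move=> i j; rewrite !mxE;
  apply: place_nat.
Qed.

(** The splittings of [a :: p] index exactly the factors [F] of the product; [F_exists] and
    [path_sum_exists] supply them in this form. *)
Lemma mplace_path_prod F F' G a p :
  (forall s1 nu s2, a :: p = s1 ++ nu :: s2 ->
     mplace (F (del_vertices G s1) nu) (F' (del_vertices G s1) nu)) ->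
  mplace (path_prod (S := S) N F G a p) (path_prod M F' G a p).
Proof.
elim: p G a => [|nu q IHq] G a rF /=; first exact: (rF [::] a [::]).
apply: mplaceM; last exact: (rF [::] a (nu :: q)).
apply: mplaceM; last exact: mplace_block.
by apply: IHq => s1 mu s2 def_q; apply: (rF (a :: s1) mu s2); rewrite def_q.
Qed.

(** Induction on the derivation of [F_exists]: each term of [F_arg] is a product of blocks and
    earlier factors. *)
Lemma mplace_F_mx G a : F_exists S M G a ->
  F_arg N (F_mx S N) G a \in unitmx /\ mplace (F_mx S N G a) (F_mx S M G a).
Proof.
elim=> {}G {}a uF _ IHF; rewrite !F_mxE; apply: mplace_inv => //.
apply: mplaceB; first exact: mplace_block.
apply: mplace_sum => j _; apply: mplace_sum => c cyc_c.
apply: mplaceZ; first exact: place_sign.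
case: (tval c) cyc_c => [|mu q] cyc_c; first exact: mplace_block.
apply: mplaceM; last exact: mplace_block.
apply: mplaceM; first exact: mplace_block.
apply: mplace_path_prod => s1 nu s2 def_q.
by apply: (IHF s1 nu s2 _).2; rewrite -def_q.
Qed.

Lemma mplace_path_sum G a w : path_sum_exists S M G a w ->
  mplace (path_sum S N G a w) (path_sum S M G a w).
Proof.
move=> exF; apply: mplace_sum => l _; apply: mplace_sum => p path_p.
apply: mplaceZ; first exact: place_sign.
have last_p : last a p = w by case/and4P: path_p => _ _ _ /eqP.
have rp : mplace (path_prod N (F_mx S N) G a p) (path_prod M (F_mx S M) G a p).
  apply: mplace_path_prod => s1 nu s2 def_p.
  exact: (mplace_F_mx (exF p path_p s1 nu s2 def_p)).2.
(* Substituting the end point for [w] makes the dimensions agree, so both casts vanish. *)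
by case: w / last_p {exF path_p}; rewrite !conform_mx_id.
Qed.

End Blocks.

End Place.

(** * Evaluation at a point as a place of K(t) *)

Section Specialization.

Variables (K : fieldType) (c : K).

(** A relation, so that fractions with a pole at [c] simply have no value. *)
Definition specializes (x : {fraction {poly K}}) (y : K) : Prop :=
  exists p q : {poly K},
    [/\ q.[c] != 0, x = tofrac p / tofrac q & y = p.[c] / q.[c]].

Lemma specializes_poly (p : {poly K}) : specializes (tofrac p) p.[c].
Proof. by exists p, 1; rewrite tofrac1 hornerC !divr1 oner_eq0. Qed.

Lemma horner_neq0 (q : {poly K}) : q.[c] != 0 -> tofrac q != 0.
Proof.
by rewrite tofrac_eq0; apply: contraNneq => ->; rewrite horner0.
Qed.

Lemma specializes_place : place specializes.
Proof.
split.
- by have := specializes_poly 0; rewrite tofrac0 horner0.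
- by have := specializes_poly 1; rewrite tofrac1 hornerC.
- move=> _ _ _ _ [p [q [q0 -> ->]]] [p' [q' [q'0 -> ->]]].
  exists (p * q' + p' * q), (q * q'); rewrite ?hornerD !hornerM mulf_neq0 //.
  by split=> //; rewrite addf_div ?horner_neq0 // tofracD !tofracM.
- move=> _ _ [p [q [q0 -> ->]]]; exists (- p), q.
  by rewrite hornerN tofracN !mulNr.
- move=> _ _ _ _ [p [q [q0 -> ->]]] [p' [q' [q'0 -> ->]]].
  exists (p * p'), (q * q'); rewrite ?hornerD !hornerM mulf_neq0 //.
  by split=> //; rewrite ?tofracM mulf_div.
- move=> _ _ [p [q [q0 -> ->]]] y0.
  have p0 : p.[c] != 0 by apply: contraNneq y0 => ->; rewrite mul0r.
  split; first by rewrite mulf_neq0 ?invr_eq0 ?horner_neq0.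
  by exists q, p; rewrite !invf_div.
- move=> _ _ _ [p [q [q0 -> ->]]] [p' [q' [q'0 /eqP + ->]]].
  rewrite eqr_div ?horner_neq0 // -!tofracM tofrac_eq => /eqP pq.
  by apply/eqP; rewrite eqr_div // -!hornerM pq.
Qed.

End Specialization.

Lemma leq_del_vertices n (G : digraph n) s :
  (#|vertices (del_vertices G s)| <= #|vertices G|)%N.
Proof.
by elim: s G => //= x s IHs G; apply: leq_trans (IHs _) (leq_del_vertex G x).
Qed.

(** * Coordinate restrictions and the identity matrix *)

Section Restriction.

Variables (K : fieldType) (D n : nat) (S : 'I_n -> {set 'I_D}).
Hypothesis hS : coord_partition S.
Local Notation R := (restr K S).

Lemma restr_tr_id mu : R mu *m (R mu)^T = 1%:M.
Proof.
apply/matrixP => i j; rewrite !mxE (bigD1 (enum_val i)) //= !mxE eqxx mul1r.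
rewrite big1 ?addr0 => [|k /negPf nik].
  by rewrite (inj_eq enum_val_inj) eq_sym.
by rewrite !mxE eq_sym nik mul0r.
Qed.

Lemma restr_tr_neq mu nu : mu != nu -> R mu *m (R nu)^T = 0.
Proof.
case: hS => _ dS _ /dS dmn; apply/matrixP => i j.
rewrite !mxE big1 // => k _; rewrite !mxE.
case: eqP => [ik|]; rewrite ?mul0r //; case: eqP => [jk|]; rewrite ?mulr0 //.
have := disjointFr dmn (enum_valP i).
by rewrite ik -jk (enum_valP j).
Qed.

Lemma sum_restr : \sum_mu (R mu)^T *m R mu = 1%:M.
Proof.
apply/matrixP => x y; rewrite summxE.
have [mu xmu] : exists mu, x \in S mu.
  case: hS => _ _ cS; have : x \in [set: 'I_D] by rewrite inE.
  by rewrite -cS => /bigcupP[mu _]; exists mu.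
have enumx nu (i : 'I_#|S nu|) : nu != mu -> (enum_val i == x) = false.
  move=> neq; apply: contraTF xmu => /eqP <-.
  case: hS => _ dS _; by rewrite (disjointFr (dS _ _ neq) (enum_valP i)).
rewrite (bigD1 mu) //= big1 ?addr0 => [|nu neq]; last first.
  by rewrite mxE big1 // => i _; rewrite !mxE enumx ?mul0r.
rewrite !mxE (bigD1 (enum_rank_in xmu x)) //= !mxE enum_rankK_in // eqxx mul1r.
rewrite big1 ?addr0 // => i neq; rewrite !mxE; case: eqP => [def_x|].
  by case/eqP: neq; apply: enum_val_inj; rewrite enum_rankK_in.
by rewrite mul0r.
Qed.

Lemma block1_neq mu nu : mu != nu -> block S (1%:M : 'M[K]_D) mu nu = 0.
Proof. by rewrite /block mulmx1; apply: restr_tr_neq. Qed.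

(** Every cycle term contains an off-diagonal block of I, so each matrix to be inverted is an
    identity. Nested factors live on smaller graphs, whence the induction. *)
Lemma F_exists1 (G : digraph n) a : F_exists S (1%:M : 'M[K]_D) G a.
Proof.
have [m] := ubnP #|vertices G|; elim: m G a => [G a|m IHm G a ltGm].
  by rewrite ltn0.
split=> [|c1 mu c2 /andP[pth _]].
  rewrite /F_arg [X in _ - X]big1 ?subr0 => [|j _].
    by rewrite /block mulmx1 restr_tr_id unitmx1.
  apply: big1 => -[[|mu q] /= _] /andP[/= pth].
    (* An empty [c] would be a self-loop, and these are deleted. *)
    by move: pth; rewrite /adj !inE eqxx !andbF.
  rewrite inE negb_or => /andP[/andP[neq _] _].
  by rewrite /cycle_prod /= [block _ _ mu a]block1_neq 1?eq_sym //
             mulmx0 scaler0.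
have aG : a \in vertices G.
  by case: c1 pth => [|x s] /= /andP[/and3P[aG _ _] _].
apply: IHm; apply: leq_ltn_trans (leq_del_vertices (del_vertex G a) c1) _.
by rewrite [#|_|](cardsD1 a) aG in ltGm.
Qed.

End Restriction.

(** * Simple paths under deletion of a vertex *)

Section Paths.

Variable n : nat.
Implicit Types (G : digraph n) (a : 'I_n) (p : seq 'I_n).

Definition simple_path G a p : bool :=
  [&& a \in vertices G, path (adj (del_loops G)) a p & uniq (a :: p)].

Lemma adj_del_vertex G a x y :
  adj (del_loops (del_vertex G a)) x y
    = [&& x != a, y != a & adj (del_loops G) x y].
Proof.
rewrite /adj !inE /=; do 2![case: (_ == a) => //=]; rewrite ?andbF //.
by rewrite andbT.
Qed.

(** The conjunct [x != a] is for the empty path, whose adjacency condition says nothing about its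
    start. *)
Lemma path_del_vertex G a x p :
  path (adj (del_loops (del_vertex G a))) x p && (x != a)
    = path (adj (del_loops G)) x p && (a \notin x :: p).
Proof.
elim: p x => [|y p IHp] x /=; first by rewrite inE eq_sym.
rewrite in_cons negb_or [a == x]eq_sym adj_del_vertex.
case: (x == a); rewrite ?andbF //= andbT -[RHS]andbA -IHp.
by rewrite -[LHS]andbA [LHS]andbC [RHS]andbA.
Qed.

Lemma simple_path_cons G a x p : simple_path G a (x :: p)
  = adj (del_loops G) a x && simple_path (del_vertex G a) x p.
Proof.
rewrite /simple_path [path _ a _]/= cons_uniq in_setD1.
case adj_ax: (adj _ a x); rewrite ?andbF //=.
case/and3P: (adj_ax) => /= -> -> _; rewrite andbT.
by rewrite andTb [LHS]andbA -path_del_vertex -andbA andbCA.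
Qed.

Lemma size_simple_path G a p : simple_path G a p -> (size p < #|vertices G|)%N.
Proof.
case/and3P=> aG pth /card_uniqP /= <-.
apply/subset_leq_card/subsetP => x; rewrite inE => /predU1P[-> //|].
elim: p a aG pth => //= y p IHp a aG /andP[/and3P[_ yG _] pth].
by rewrite inE => /predU1P[-> //|]; apply: IHp yG pth.
Qed.

End Paths.

(** * Blocks under linear operations and field morphisms *)

Section BlockMorphisms.

Variables (D n : nat) (S : 'I_n -> {set 'I_D}).

Lemma blockD (K : fieldType) (A B : 'M[K]_D) mu nu :
  block S (A + B) mu nu = block S A mu nu + block S B mu nu.
Proof. by rewrite /block mulmxDr mulmxDl. Qed.

Lemma blockZ (K : fieldType) c (A : 'M[K]_D) mu nu :
  block S (c *: A) mu nu = c *: block S A mu nu.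
Proof. by rewrite /block -scalemxAr -scalemxAl. Qed.

Lemma block_map (K L : fieldType) (f : {rmorphism K -> L}) (A : 'M[K]_D) mu nu :
  block S (map_mx f A) mu nu = map_mx f (block S A mu nu).
Proof.
have map_restr l : map_mx f (restr K S l) = restr L S l.
  by apply/matrixP => i j; rewrite !mxE rmorph_nat.
by rewrite /block !map_mxM -map_trmx !map_restr.
Qed.

End BlockMorphisms.

(** * Sums over sequences, split by their head *)

Section TupleSums.

Variables (T : finType) (V : nmodType) (P : pred (seq T)) (f : seq T -> V).

Lemma sum_tuple0 :
  \sum_(p : 0.-tuple T | P p) f p = if P [::] then f [::] else 0.
Proof.
rewrite big_mkcond (big_pred1 [tuple]) //= => p.
by rewrite tuple0; apply/esym/eqP/tuple0.
Qed.

Lemma sum_tupleS l :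
  \sum_(p : l.+1.-tuple T | P p) f p
    = \sum_x \sum_(q : l.-tuple T | P (x :: q)) f (x :: q).
Proof.
rewrite pair_big_dep /=.
rewrite (reindex (fun xq : T * l.-tuple T => [tuple of xq.1 :: xq.2])) //=.
exists (fun p => (thead p, [tuple of behead p])) => [[x q] _|p _].
  by congr (_, _); apply: val_inj.
by rewrite -tuple_eta.
Qed.

Lemma sum_tuples_recl m : (0 < m)%N ->
  \sum_(l < m) \sum_(p : l.-tuple T | P p) f p
    = (if P [::] then f [::] else 0)
      + \sum_x \sum_(l < m.-1) \sum_(q : l.-tuple T | P (x :: q)) f (x :: q).
Proof.
case: m => // m _; rewrite big_ord_recl sum_tuple0; congr (_ + _).
by rewrite exchange_big; apply: eq_bigr => l _; apply: sum_tupleS.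
Qed.

End TupleSums.

(** * Path sums as block columns of the inverse *)

Section PathColumns.

Variables (K : fieldType) (D n : nat) (S : 'I_n -> {set 'I_D}).
Hypothesis hS : coord_partition S.
Variable N : 'M[K]_D.
Implicit Types (G : digraph n) (a : 'I_n).
Local Notation R := (restr K S).
Local Notation F := (F_mx S N).

Definition path_term G a (p : seq 'I_n) : 'M[K]_(D, #|S a|) :=
  (-1) ^+ size p *: ((R (last a p))^T *m path_prod N F G a p).

(* Stacking the blocks [path_sum S N G a w] over all w makes the size
   independent of the end point of the path. *)
Definition path_col m G a : 'M[K]_(D, #|S a|) :=
  \sum_(l < m) \sum_(p : l.-tuple 'I_n | simple_path G a p) path_term G a p.

Lemma path_term_cons G a nu p : path_term G a (nu :: p)
  = - (path_term (del_vertex G a) nu p *m block S N nu a *m F G a).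
Proof.
rewrite /path_term /= exprS mulN1r scaleNr -!scalemxAl.
by rewrite !mulmxA.
Qed.

Lemma path_colS m G a : a \in vertices G ->
  path_col m.+1 G a
    = ((R a)^T - \sum_(nu | adj (del_loops G) a nu)
                   path_col m (del_vertex G a) nu *m block S N nu a) *m F G a.
Proof.
move=> aG; rewrite /path_col sum_tuples_recl //.
rewrite {1}/simple_path aG /= /path_term /= expr0 scale1r mulmxBl.
congr (_ + _).
rewrite mulmx_suml -sumrN [RHS]big_mkcond; apply: eq_bigr => nu _.
case: ifP => adj_nu; last first.
  rewrite big1 // => l _; rewrite big1 // => q.
  by rewrite simple_path_cons adj_nu.
rewrite !mulmx_suml -sumrN; apply: eq_bigr => l _.
rewrite !mulmx_suml -sumrN; apply: eq_big => q.
  by rewrite simple_path_cons adj_nu.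
by move=> _; rewrite -path_term_cons.
Qed.

(** Simple paths are shorter than the number of vertices, so a larger bound only adds empty sums. *)
Lemma path_col_stable m m' G a :
  (#|vertices G| <= m)%N -> (#|vertices G| <= m')%N ->
  path_col m G a = path_col m' G a.
Proof.
suff stable k : (#|vertices G| <= k)%N ->
    path_col k G a = path_col #|vertices G| G a.
  by move=> lem lem'; rewrite !stable.
move=> lek.
pose g l :=
  \sum_(p : l.-tuple 'I_n | simple_path G a p) path_term G a p.
rewrite /path_col (big_ord_widen k g lek).
rewrite [LHS](bigID (fun l : 'I_k => l < #|vertices G|)%N) /=.
rewrite [X in _ + X]big1 ?addr0 // => l; rewrite -leqNgt => leGl.
rewrite big1 // => p /size_simple_path.
by rewrite size_tuple ltnNge leGl.
Qed.

(** Edges may carry zero blocks, which only add zero terms; thus the graph of M - I can serve for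
    the deformed matrix. *)
Definition covers_blocks G : Prop :=
  forall mu nu, mu \in vertices G -> nu \in vertices G -> mu != nu ->
  (nu, mu) \notin edges G -> block S N mu nu = 0.

Lemma covers_del_vertex G a : covers_blocks G -> covers_blocks (del_vertex G a).
Proof.
move=> covG mu nu; rewrite !inE /= => /andP[mua muG] /andP[nua nuG] neq.
by rewrite mua nua !andbT; apply: covG.
Qed.

Lemma bare_cycle_cons G a x p : is_bare_cycle (del_loops G) a (x :: p)
  = [&& adj (del_loops G) a x, simple_path (del_vertex G a) x p
      & adj (del_loops G) (last x p) a].
Proof.
rewrite andbA -simple_path_cons /is_bare_cycle rcons_path /simple_path -andbA.
case adj_l: (adj _ _ a); rewrite ?andbF ?andbT //=.
by case/and3P: adj_l => _ /= ->.
Qed.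

Lemma last_simple_path G a p : simple_path G a p -> last a p \in vertices G.
Proof.
case/and3P=> aG pth _; elim: p a aG pth => //= x p IHp a aG.
by case/andP=> /and3P[_ xG _]; apply: IHp.
Qed.

(** Paths that no edge closes into a cycle can be included, since their block back to [a] is zero;
    the closing blocks then merge into [R a *m N]. *)
Lemma F_argE G a : a \in vertices G -> covers_blocks G ->
  F_arg N F G a = block S N a a
    - \sum_(nu | adj (del_loops G) a nu)
        R a *m N *m path_col n.-1 (del_vertex G a) nu *m block S N nu a.
Proof.
move=> aG covG; rewrite /F_arg; congr (_ - _).
(* The sign must depend on the sequence alone for [sum_tuples_recl] to apply. *)
transitivity
  (\sum_(j < n) \sum_(c : j.-tuple 'I_n | is_bare_cycle (del_loops G) a c)
    (-1) ^+ (size c).+1 *: cycle_prod N F G a c).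
  by apply: eq_bigr => j _; apply: eq_bigr => c _; rewrite size_tuple.
rewrite (sum_tuples_recl (is_bare_cycle (del_loops G) a)
  (fun c => (-1) ^+ (size c).+1 *: cycle_prod N F G a c));
  last exact: leq_ltn_trans (ltn_ord a).
rewrite {1}/is_bare_cycle /= {1}/adj !inE eqxx !andbF /= add0r.
rewrite [RHS]big_mkcond; apply: eq_bigr => nu _.
rewrite mulmx_sumr mulmx_suml.
case: ifP => adj_nu; last first.
  rewrite big1 // => l _; rewrite big1 // => q.
  by rewrite bare_cycle_cons adj_nu.
apply: eq_bigr => l _; rewrite mulmx_sumr mulmx_suml.
under eq_bigl => q do rewrite bare_cycle_cons adj_nu /=.
rewrite big_mkcondr; apply: eq_bigr => q path_q.
(* The cycle is two steps longer than [q], so the signs agree. *)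
rewrite /path_term !exprS !mulN1r opprK -scalemxAr -scalemxAl !mulmxA.
case: ifP => // /negbT adj_la.
suff -> : R a *m N *m (R (last nu q))^T = 0 by rewrite !mul0mx scaler0.
have := last_simple_path path_q; rewrite !inE => /andP[la lG].
apply: covG => //; first by rewrite eq_sym.
by move: adj_la; rewrite /adj /= lG aG !inE /= la andbT.
Qed.

(** A non-neighbour [nu] of [a] adds zero: it differs from [mu] and the restrictions are orthogonal,
    or its block is zero. Over all [nu] the projectors add up to I. *)
Lemma sum_adj_block G a mu : a \in vertices G -> mu \in vertices G ->
    mu != a -> covers_blocks G ->
  \sum_(nu | adj (del_loops G) a nu) R mu *m (R nu)^T *m block S N nu a
    = block S N mu a.
Proof.
move=> aG muG mua covG.
transitivity (\sum_nu R mu *m (R nu)^T *m block S N nu a).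
  rewrite big_mkcond; apply: eq_bigr => nu _; case: ifP => // /negbT adj_nu.
  have [mu_nu|/(restr_tr_neq K hS)->] := eqVneq mu nu; last by rewrite mul0mx.
  rewrite covG ?mulmx0 -?mu_nu //; move: adj_nu.
  by rewrite -mu_nu /adj /= aG muG inE /= eq_sym mua andbT.
transitivity (R mu *m (\sum_nu (R nu)^T *m R nu) *m (N *m (R a)^T)).
  by rewrite mulmx_sumr mulmx_suml; apply: eq_bigr => nu _;
    rewrite /block !mulmxA.
by rewrite (sum_restr K hS) mulmx1 mulmxA.
Qed.

Hypothesis F_arg_unit : forall G a, F_arg N F G a \in unitmx.

Lemma path_colP m G a mu : a \in vertices G -> mu \in vertices G ->
    covers_blocks G -> (#|vertices G| <= m)%N ->
  R mu *m N *m path_col m G a = R mu *m (R a)^T.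
Proof.
elim: m G a mu => [|m IHm] G a mu aG muG covG.
  by rewrite leqn0 => /eqP/cards0_eq V0; rewrite V0 inE in aG.
rewrite (cardsD1 a) aG => leGm.
rewrite path_colS // mulmxA mulmxBr mulmx_sumr.
have [->|mua] := eqVneq mu a.
  (* In the row of [a] the left factor is [F_arg], whose inverse is [F]. *)
  rewrite restr_tr_id F_mxE -[RHS](mulmxV (F_arg_unit G a)); congr (_ *m _).
  rewrite F_argE //; congr (_ - _); apply: eq_bigr => nu _.
  rewrite mulmxA (@path_col_stable m n.-1) //.
  (* Without [a] at most [n.-1] vertices remain, so both length bounds give the same column. *)
  rewrite -ltnS prednK; last exact: leq_ltn_trans (ltn_ord a).
  rewrite /=; have := max_card (mem (vertices G)).
  by rewrite card_ord (cardsD1 a) aG.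
(* In any other row, induction turns the sum into that of [sum_adj_block], which cancels the block
   at [(mu, a)]. *)
rewrite (restr_tr_neq K hS mua) -[RHS](mul0mx _ (F G a)); congr (_ *m _).
rewrite -[X in X - _]/(block S N mu a) -(sum_adj_block aG muG mua covG).
apply/eqP; rewrite subr_eq0; apply/eqP/eq_bigr => nu /and3P[_ nuG].
rewrite inE /= => /andP[_ a_nu]; rewrite [RHS]mulmxA IHm ?inE //.
- by rewrite eq_sym a_nu.
- by rewrite mua.
- exact: covers_del_vertex.
Qed.

(** Multiplication by [R w] kills the paths that end elsewhere; on the others the cast is the
    identity. *)
Lemma path_sumE G a w : path_sum S N G a w = R w *m path_col n G a.
Proof.
rewrite /path_col mulmx_sumr; apply: eq_bigr => l _.
rewrite mulmx_sumr big_mkcond [RHS]big_mkcond; apply: eq_bigr => p _.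
have -> : is_path (del_loops G) a w p = simple_path G a p && (last a p == w).
  by rewrite /is_path /simple_path -!andbA.
case: (simple_path G a p) => //=; rewrite /path_term size_tuple.
rewrite -scalemxAr mulmxA.
case: eqVneq => [<-|neq]; first by rewrite restr_tr_id mul1mx conform_mx_id.
by rewrite (restr_tr_neq K hS) 1?eq_sym // mul0mx scaler0.
Qed.

Lemma block_inv_path_sum G a w : N \in unitmx -> covers_blocks G ->
  vertices G = [set: 'I_n] -> block S (invmx N) w a = path_sum S N G a w.
Proof.
move=> uN covG VG; rewrite path_sumE /block -mulmxA; congr (_ *m _).
apply: (canLR (mulKmx uN)); rewrite -[RHS]mul1mx -[LHS]mul1mx.
rewrite -(sum_restr K hS) !mulmx_suml.
apply: eq_bigr => mu _; rewrite -!mulmxA; congr (_ *m _); apply/esym.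
by rewrite mulmxA path_colP // ?VG ?inE // (leq_trans (max_card _)) ?card_ord.
Qed.

End PathColumns.

(** * Descent of the formula from K(t) to K *)

Lemma block_inv_partition_graph (K : fieldType) (D n : nat) (M : 'M[K]_D)
    (S : 'I_n -> {set 'I_D}) (a w : 'I_n) :
  M \in unitmx -> coord_partition S ->
  let G := partition_graph S (M - 1%:M) in
  path_sum_exists S M G a w ->
  block S (invmx M) w a = path_sum S M G a w.
Proof.
move=> hM hS G exM.
pose f : {rmorphism K -> {fraction {poly K}}} := @tofrac {poly K} \o polyC.
(* Written so that its off-diagonal blocks are visibly multiples of those of M - I. *)
pose N := 1%:M + (1 - tofrac 'X) *: map_mx f (M - 1%:M).
have rP (c : K) : place (specializes c) := specializes_place c.
have rN (c : K) : mplace (specializes c) N (1%:M + (1 - c) *: (M - 1%:M)).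
  apply: (mplaceD (rP c)) => [i j|].
    by rewrite !mxE; apply: (place_nat (rP c)).
  apply: (mplaceZ (rP c)) => [|i j].
    apply: (placeD (rP c)); first exact: (place1 (rP c)).
    apply: (placeN (rP c)).
    by have := specializes_poly c 'X; rewrite hornerX.
  rewrite mxE; have := specializes_poly c ((M - 1%:M) i j)%:P.
  by rewrite hornerC.
have rN0 : mplace (specializes 0) N M.
  by have := rN 0; rewrite subr0 scale1r addrC subrK.
have rN1 : mplace (specializes 1) N 1%:M.
  by have := rN 1; rewrite subrr scale0r addr0.
have [uN rNV] := mplace_inv (rP 0) rN0 hM.
have rB :
    mplace (specializes 0) (block S (invmx N) w a) (block S (invmx M) w a).
  exact: mplace_block.
(* Residues being unique, it remains to see that the path sum for M is also a residue of this
   block. *)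
refine (mplace_fun (rP 0) rB _).
(* Invertibility lifts from the residue at t = 1, where [N] becomes I, for all graphs and vertices
   at once. *)
have uF H b : F_arg N (F_mx S N) H b \in unitmx.
  exact: (mplace_F_mx (rP 1) rN1 (F_exists1 K hS H b)).1.
rewrite (@block_inv_path_sum _ _ _ _ hS _ uF G) //.
  exact: mplace_path_sum.
move=> mu nu _ _ neq; rewrite inE negbK /= => /eqP M0.
rewrite /N blockD (block1_neq _ hS neq) add0r blockZ block_map M0.
by rewrite map_mx0 scaler0.
Qed.

Theorem theorem3p2 (R : realType) (D n : nat) (M : 'M[R[i]]_D)
    (S : 'I_n -> {set 'I_D}) (hM : M \in unitmx) (hS : coord_partition S)
    (a w : 'I_n) :
  let G := partition_graph S (M - 1%:M) in
  path_sum_exists S M G a w ->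
  block S (invmx M) w a = path_sum S M G a w.
Proof. exact: block_inv_partition_graph. Qed.
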